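(* Suppose that $\phi''_F > 0$ and $\phi''_{2F} \in \mathbb{R}\setminus\{0\}$. Then, for sufficiently large $N$, the operator $L^{qcf}$ is not coercive. More precisely, there exist $N_0 \in \mathbb{N}$ and constants $C_1 \ge C_2 > 0$ (independent of $N$ and $K$) such that, for all integers $N \ge N_0$ and all integers $K$ with $2 \le K \le N/2$, $$ -C_1 N^{1/2} \;\le\; \inf_{\substack{\mathbf{v} \in \mathcal{V}_0 \\ \|D\mathbf{v}\|_{\ell^2_\epsilon} = 1}} \langle L^{qcf}\mathbf{v}, \mathbf{v}\rangle \;\le\; -C_2 N^{1/2}. $$
   Context: Let $\phi''_F := \phi''(F)$ and $\phi''_{2F} := \phi''(2F)$ be real numbers, where $\phi$ is an interatomic pair potential and $F>0$ (only these two real numbers enter). Let $N, K$ be integers with $0 < K < N-1$ and $\epsilon = 1/N$. Vectors $\mathbf{v}\in\mathbb{R}^{2N+1}$ are indexed by $j=-N,\dots,N$. The atomistic region is $\mathcal{A} = \{-K,\dots,K\}$ and the continuum region is $\mathcal{C} = \{-N+1,\dots,N-1\}\setminus\mathcal{A}$. The linearized force-based quasicontinuum (QCF) operator $L^{qcf}:\mathbb{R}^{2N+1}\to\mathbb{R}^{2N+1}$ is defined by $(L^{qcf}\mathbf{v})_{\pm N}=0$, $$(L^{qcf}\mathbf{v})_j = \phi''_F\,\frac{-v_{j+1}+2v_j-v_{j-1}}{\epsilon^2} + \phi''_{2F}\,\frac{-v_{j+2}+2v_j-v_{j-2}}{\epsilon^2}\quad\text{for } j\in\mathcal{A},$$ $$(L^{qcf}\mathbf{v})_j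 = (\phi''_F+4\phi''_{2F})\,\frac{-v_{j+1}+2v_j-v_{j-1}}{\epsilon^2}\quad\text{for } j\in\mathcal{C}.$$ $\mathcal{V}_0 = \{\mathbf{v}\in\mathbb{R}^{2N+1}: v_{-N}=v_N=0\}$. The backward difference is $D\mathbf{v}=(Dv_j)_{j=-N+1}^{N}\in\mathbb{R}^{2N}$, $Dv_j = (v_j-v_{j-1})/\epsilon$. The inner product is $\langle\mathbf{v},\mathbf{w}\rangle = \sum_j \epsilon v_jw_j$ and the norm is $\|\mathbf{v}\|_{\ell^2_\epsilon} = (\epsilon\sum_j |v_j|^2)^{1/2}$, with sums over all indices of the vectors. Not coercive means that $\langle L^{qcf}\mathbf{v},\mathbf{v}\rangle$ is not positive for all $\mathbf{v}\in\mathcal{V}_0\setminus\{0\}$. *)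

(* Defs.v *)
From mathcomp Require Import all_boot all_order all_algebra.
From mathcomp Require Import all_classical all_reals ereal.

Set Implicit Arguments.
Unset Strict Implicit.
Unset Printing Implicit Defensive.

Import Order.TTheory GRing.Theory Num.Theory.
Local Open Scope classical_set_scope.
Local Open Scope ring_scope.

Section QCF.
Variable R : realType.

Definition mesh (N : nat) : R := N%:R^-1.

(* Vectors of R^{2N+1} are row vectors; the ordinal i in {0, ..., 2N} stands
   for the lattice index j = i - N in {-N, ..., N}. *)
Definition site (N : nat) (i : 'I_(2 * N).+1) : int := i%:Z - N%:Z.

(* v_j for an integer j; meaningful only when -N <= j <= N ([inord] returns
   ord0 on out-of-range values). *)
Definition entry (N : nat) (v : 'rV[R]_(2 * N).+1) (j : int) : R :=
  v 0 (inord (absz (j + N%:Z))).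

(* When 0 < K < N - 1 the indices j +- 1 and j +- 2 below are all within
   {-N, ..., N}, and the last branch is reached exactly for j in the continuum
   region. *)
Definition Lqcf (phiF phi2F : R) (N K : nat) (v : 'rV[R]_(2 * N).+1) :
    'rV[R]_(2 * N).+1 :=
  \row_i
    let j := site i in
    if `|j| == N%:Z then 0
    else if `|j| <= K%:Z then
      phiF * ((- entry v (j + 1) + 2 * entry v j - entry v (j - 1)) / mesh N ^+ 2)
      + phi2F *
        ((- entry v (j + 2) + 2 * entry v j - entry v (j - 2)) / mesh N ^+ 2)
    else
      (phiF + 4 * phi2F) *
        ((- entry v (j + 1) + 2 * entry v j - entry v (j - 1)) / mesh N ^+ 2).

Definition V0 (N : nat) : set 'rV[R]_(2 * N).+1 :=
  [set v | entry v (- N%:Z) = 0 /\ entry v N%:Z = 0].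

(* The ordinal i in {0, ..., 2N-1} stands for j = i - N + 1, so that v_j and
   v_{j-1} are the entries i+1 and i of v. *)
Definition Ddiff (N : nat) (v : 'rV[R]_(2 * N).+1) : 'rV[R]_(2 * N) :=
  \row_i ((v 0 (lift ord0 i) - v 0 (widen_ord (leqnSn _) i)) / mesh N).

Definition ip (eps : R) (n : nat) (v w : 'rV[R]_n) : R :=
  \sum_i eps * v 0 i * w 0 i.

Definition l2norm (eps : R) (n : nat) (v : 'rV[R]_n) : R :=
  Num.sqrt (eps * \sum_i `|v 0 i| ^+ 2).

Definition coercive (N : nat)
    (L : 'rV[R]_(2 * N).+1 -> 'rV[R]_(2 * N).+1) : Prop :=
  forall v, V0 v -> v != 0 -> 0 < ip (mesh N) (L v) v.

(* The infimum is taken in the extended reals, so unboundedness below would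
   show up as -oo. *)
Definition rayleigh_inf (N : nat)
    (L : 'rV[R]_(2 * N).+1 -> 'rV[R]_(2 * N).+1) : \bar R :=
  ereal_inf [set (ip (mesh N) (L v) v)%:E | v in
    [set v | V0 v /\ l2norm (mesh N) (Ddiff v) = 1]].

End QCF.

(* Main.v *)
Require Import Defs.
From mathcomp Require Import all_boot all_order all_algebra.
From mathcomp Require Import all_classical all_reals ereal.
From mathcomp Require Import ring lra zify.

Import Order.TTheory GRing.Theory Num.Theory.
Local Open Scope ring_scope.

(** Let [f i = v_(i - N)] for [0 <= i <= 2 N] and write [E] for the sum of the
squared first differences of [f], so that the constraint on the strain reads
[N * E = 1]. A second neighbour second difference is four times the nearest
neighbour one plus a fourth difference. Hence [<L v, v>] is the local
form [(phiF + 4 phi2F) N E] minus [phi2F N] times the sum of [(d^4 f) f] over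
the atomistic region only ([ip_Lqcf]).

Summing that last sum by parts twice ([sum_diff4_mul]) leaves the sum of
[(d^2 f)^2] and products [(d^2 f) (d f)] at the two interfaces, all of which
are at most a constant times [E], and one pair of terms that is not: the
jump between the two interfaces of [(d^3 f) f]. So, up to a constant
independent of [N] and [K], the form equals [- phi2F N] times that jump
([qcf_form_interface]). This jump has no definite sign and can be
made large, so it decides everything, whatever the sign of [phi2F].

Lower bound: when [N E = 1] each first difference is at most [N^(-1/2)], while
[f] itself stays bounded because it vanishes at the end of a chain of length
[2 N] ([norm_le_of_energy]), so [N] times the jump is [O(N^(1/2))]
([interface_le]).

Upper bound: take a tent centred at the middle of the chain, which is of order
one at the right interface and has no third difference at the left one, and
displace one continuum site by [+- N^(-1/2)], at distance two from the last
atom. This spike costs an energy of order one, but makes [d^3 f] of order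
[N^(-1/2)] at the right interface, and its sign is free
([interface_spiked_tent], [rayleigh_upper]). *)

(** * Summation by parts for finite differences *)

Definition diff1 {R : zmodType} (f : nat -> R) (i : nat) : R := f i.+1 - f i.
Definition diff2 {R : zmodType} (f : nat -> R) := diff1 (diff1 f).
Definition diff3 {R : zmodType} (f : nat -> R) := diff1 (diff2 f).
Definition diff4 {R : zmodType} (f : nat -> R) := diff1 (diff3 f).

Definition energy {R : pzRingType} (f : nat -> R) (n : nat) : R :=
  \sum_(i < n) diff1 f i ^+ 2.

(** The right interface is at [p + n + 1] and the left one at [p + 2]: the [n]
sites [p + 2, ..., p + n + 1] are the centres of the fourth differences
[diff4 f p, ..., diff4 f (p + n - 1)]. *)
Definition interface {R : pzRingType} (f : nat -> R) (p n : nat) : R :=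
  diff3 f (p + n) * f (p + n).+1 - diff3 f p * f p.+2.

Lemma sum_diff2_mul {R : comPzRingType} (f : nat -> R) (n : nat) :
  \sum_(i < n) diff2 f i * f i.+1 =
  diff1 f n * f n - diff1 f 0 * f 0 - energy f n.
Proof.
rewrite /energy; elim: n => [|n IH]; first by rewrite !big_ord0 /diff1; ring.
by rewrite !big_ord_recr /= IH /diff2 /diff1; ring.
Qed.

(** Green's formula for the discrete bilaplacian: no boundary condition holds at
the two interfaces, so all four boundary terms survive. *)
Lemma sum_diff4_mul {R : comPzRingType} (f : nat -> R) (p n : nat) :
  \sum_(m < n) diff4 f (p + m) * f (p + m).+2 =
  \sum_(m < n) diff2 f (p + m).+1 ^+ 2 + interface f p n
  - diff2 f (p + n) * diff1 f (p + n).+1 + diff2 f p.+1 * diff1 f p.+1.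
Proof.
rewrite /interface; elim: n => [|n IH].
  by rewrite !big_ord0 addn0 /diff3 /diff2 /diff1; ring.
by rewrite !big_ord_recr /= IH addnS /diff4 /diff3 /diff2 /diff1; ring.
Qed.

(** * Bounds by the strain energy *)

Lemma energy_window {R : realDomainType} (f : nat -> R) (p n M : nat) :
  (p + n <= M)%N -> \sum_(m < n) diff1 f (p + m) ^+ 2 <= energy f M.
Proof.
move=> le_pnM; rewrite /energy -(subnKC le_pnM) !big_split_ord /= addrAC lerDr.
by rewrite addr_ge0 ?sumr_ge0 // => *; rewrite sqr_ge0.
Qed.

Lemma diff1_sqr_le {R : realDomainType} (f : nat -> R) (k M : nat) :
  (k < M)%N -> diff1 f k ^+ 2 <= energy f M.
Proof.
move=> ltkM; have := @energy_window R f k 1 M.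
by rewrite big_ord1 addn0; apply; rewrite addn1.
Qed.

Lemma diff2_sum_le {R : realFieldType} (f : nat -> R) (p n M : nat) :
  (p + n < M)%N -> \sum_(m < n) diff2 f (p + m) ^+ 2 <= 4 * energy f M.
Proof.
move=> lt_pnM.
have h1 := @energy_window R f p n M (ltnW lt_pnM).
have h2 := @energy_window R f p.+1 n M lt_pnM.
apply: (@le_trans _ _ (2 * \sum_(m < n) diff1 f (p.+1 + m) ^+ 2
                       + 2 * \sum_(m < n) diff1 f (p + m) ^+ 2)); last lra.
rewrite !mulr_sumr -big_split /=; apply: ler_sum => m _.
rewrite addSn /diff2 {1}/diff1.
set x := diff1 f _; set y := diff1 f _.
have := sqr_ge0 (x + y); rewrite !expr2; nra.
Qed.

Lemma diff2_diff1_le {R : realFieldType} (f : nat -> R) (j k M : nat) :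
  (j.+1 < M)%N -> (k < M)%N -> `|diff2 f j * diff1 f k| <= 2 * energy f M.
Proof.
move=> ltj ltk.
have h1 := diff1_sqr_le f j.+1 M ltj.
have h2 := diff1_sqr_le f j M (ltnW ltj).
have h3 := diff1_sqr_le f k M ltk.
rewrite /diff2 {1}/diff1.
move: h1 h2 h3; set x := diff1 f _; set y := diff1 f _; set z := diff1 f _.
move=> h1 h2 h3.
have s1 := sqr_ge0 (x + z); have s2 := sqr_ge0 (x - z).
have s3 := sqr_ge0 (y + z); have s4 := sqr_ge0 (y - z).
by move: h1 h2 h3 s1 s2 s3 s4; rewrite ler_norml !expr2 => *; apply/andP; split; nra.
Qed.

(** The quadratic form of the quasicontinuum operator on the nodal values of a
vector: the local continuum form, corrected in the atomistic window by the
fourth difference by which the second neighbour interaction differs from its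
local approximation. *)
Definition qcf_form {R : realFieldType} (phiF phi2F : R) (N p n : nat)
    (f : nat -> R) : R :=
  (phiF + 4 * phi2F) * (N%:R * energy f (2 * N))
  - phi2F * (N%:R * \sum_(m < n) diff4 f (p + m) * f (p + m).+2).

(** The only part of the form that the strain energy does not control uniformly
in [N] is the interface term. In the constant, 4 comes from the
local form, 4 from the squared second differences and 2 from each of the two
products of differences at the interfaces. *)
Lemma qcf_form_interface {R : realFieldType} (phiF phi2F : R) (N p n : nat)
    (f : nat -> R) :
  0 <= phiF -> (p + n + 2 < 2 * N)%N -> N%:R * energy f (2 * N) = 1 ->
  `|qcf_form phiF phi2F N p n f + phi2F * (N%:R * interface f p n)|
    <= phiF + 12 * `|phi2F|.
Proof.
move=> F0 hp E1; rewrite /qcf_form E1 sum_diff4_mul.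
have N0 : 0 <= N%:R :> R by [].
have scale c x : x <= c * energy f (2 * N) -> N%:R * x <= c.
  by move=> hx; rewrite -[leRHS]mulr1 -[X in _ <= _ * X]E1 mulrCA; apply: ler_wpM2l.
have [h1 h2] : 0 <= N%:R * \sum_(m < n) diff2 f (p + m).+1 ^+ 2
  /\ N%:R * \sum_(m < n) diff2 f (p + m).+1 ^+ 2 <= 4.
  split; first by rewrite mulr_ge0 ?sumr_ge0 // => *; rewrite sqr_ge0.
  by apply/scale/(@diff2_sum_le _ f p.+1); lia.
have b j k : (j.+1 < 2 * N)%N -> (k < 2 * N)%N ->
    `|N%:R * (diff2 f j * diff1 f k)| <= 2.
  by move=> ltj ltk; rewrite normrM normr_nat; apply/scale/diff2_diff1_le.
have h3 := b (p + n)%N (p + n).+1 ltac:(lia) ltac:(lia).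
have h4 := b p.+1 p.+1 ltac:(lia) ltac:(lia).
move: h1 h2 h3 h4; set S := \sum_(m < n) diff2 f (p + m).+1 ^+ 2.
set R1 := _ * diff1 f _; set R2 := _ * diff1 f _ => h1 h2 h3 h4.
have -> : (phiF + 4 * phi2F) * 1 -
   phi2F * (N%:R * (S + interface f p n - R1 + R2)) +
   phi2F * (N%:R * interface f p n) =
   phiF + phi2F * (4 - N%:R * S + N%:R * R1 - N%:R * R2) by ring.
apply: (le_trans (ler_normD _ _)); rewrite (ger0_norm F0) lerD2l normrM mulrC.
apply: ler_wpM2r => //; move: h3 h4; rewrite !ler_norml => /andP[? ?] /andP[? ?].
by apply/andP; split; lra.
Qed.

(** A discrete Sobolev inequality: a displacement clamped at one end is the
sum of at most [2 N] increments of mean square [1 / (2 N^2)]. *)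
Lemma norm_le_of_energy {R : realFieldType} (f : nat -> R) (N k : nat) :
  f 0%N = 0 -> (k <= 2 * N)%N -> N%:R * energy f (2 * N) = 1 -> `|f k| <= 2.
Proof.
move=> f0 lek E1.
have N0 : 0 < N%:R :> R.
  by rewrite ltr0n lt0n; apply/eqP => N0; move: E1; rewrite N0 mul0r; lra.
have -> : f k = \sum_(m < k) diff1 f m.
  by rewrite -(big_mkord xpredT) /= telescope_sumr // f0 subr0.
apply: (le_trans (ler_norm_sum _ _ _)).
(* Young's inequality, weighted so that both halves sum to order one, replaces
   Cauchy-Schwarz. *)
have amgm i : `|diff1 f i| <= (N%:R * diff1 f i ^+ 2 + N%:R^-1) / 2.
  rewrite -[diff1 f i ^+ 2]real_normK ?num_real //; set x := `|_|.
  rewrite ler_pdivlMr // -subr_ge0.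
  have -> : N%:R * x ^+ 2 + N%:R^-1 - x * 2 = N%:R * (x - N%:R^-1) ^+ 2.
    by field; rewrite gt_eqF.
  by rewrite mulr_ge0 ?sqr_ge0 ?ltW.
apply: (le_trans (ler_sum _ (fun (i : 'I_k) _ => amgm i))).
rewrite -mulr_suml big_split /= -mulr_sumr sumr_const card_ord -[_ *+ k]mulr_natr.
have h1 : N%:R * (\sum_(i < k) diff1 f i ^+ 2) <= 1.
  by rewrite -[leRHS]E1; apply: ler_wpM2l; [exact: ltW | exact: (@energy_window _ f 0)].
have h2 : N%:R^-1 * k%:R <= 2 :> R.
  rewrite mulrC ler_pdivrMr // -natrM ler_nat; lia.
rewrite ler_pdivrMr //; lra.
Qed.

(** Each factor [diff3 f] is [O(N^(-1/2))] and each value of [f] is [O(1)], so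
the factor [N] in front leaves [N^(1/2)]. *)
Lemma interface_le {R : rcfType} (f : nat -> R) (N p n : nat) :
  f 0%N = 0 -> (p + n + 2 < 2 * N)%N -> N%:R * energy f (2 * N) = 1 ->
  `|N%:R * interface f p n| <= 16 * Num.sqrt N%:R.
Proof.
move=> f0 hp E1; set r := Num.sqrt _.
have r0 : 0 <= r by exact: sqrtr_ge0.
have rr : N%:R = r * r :> R by rewrite -expr2 sqr_sqrtr.
have d k : (k < 2 * N)%N -> `|r * diff1 f k| <= 1.
  move=> ltk; rewrite -(ler_sqr) ?nnegrE // real_normK ?num_real // expr1n.
  rewrite exprMn expr2 -rr -[leRHS]E1; apply: ler_wpM2l => //.
  exact: diff1_sqr_le.
have t k : (k.+2 < 2 * N)%N -> `|r * diff3 f k| <= 4.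
  move=> ltk; have := d k.+2 ltk; have := d k.+1 (ltnW ltk).
  have := d k (ltnW (ltnW ltk)).
  have -> : r * diff3 f k = r * diff1 f k.+2 - 2 * (r * diff1 f k.+1) + r * diff1 f k.
    by rewrite /diff3 /diff2 /diff1; ring.
  rewrite !ler_norml => /andP[? ?] /andP[? ?] /andP[? ?].
  by apply/andP; split; lra.
have u k l : (k.+2 < 2 * N)%N -> (l <= 2 * N)%N ->
    `|N%:R * (diff3 f k * f l)| <= 8 * r.
  move=> ltk lel; rewrite rr.
  have -> : r * r * (diff3 f k * f l) = r * (r * diff3 f k * f l) by ring.
  rewrite normrM (ger0_norm r0) mulrC; apply: ler_wpM2r => //.
  have -> : 8 = 4 * 2 :> R by ring.
  by rewrite normrM; apply: ler_pM => //; [exact: t | exact: (@norm_le_of_energy _ f N)].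
rewrite /interface mulrBr; apply: (le_trans (ler_normB _ _)).
have h1 := u (p + n)%N (p + n).+1 ltac:(lia) ltac:(lia).
have h2 := u p p.+2 ltac:(lia) ltac:(lia).
lra.
Qed.

(** * The quasicontinuum form in terms of nodal values *)

Definition nodal {R : Type} {n : nat} (v : 'rV[R]_n.+1) (i : nat) : R :=
  v 0 (inord i).

(** The difference stencils are indexed by their leftmost node: at the site
[k + 1] the second difference starts at [k] and the fourth one at [k - 1]. *)
Lemma Lqcf_nodal {R : realType} (phiF phi2F : R) (N K k : nat)
    (v : 'rV[R]_(2 * N).+1) :
  (0 < N)%N -> (K + 2 <= N)%N -> (k.+1 < 2 * N)%N ->
  nodal (Lqcf phiF phi2F K v) k.+1 =
  - (phiF + 4 * phi2F) * N%:R ^+ 2 * diff2 (nodal v) k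
  - (if (N - K <= k.+1 <= N + K)%N then
       phi2F * N%:R ^+ 2 * diff4 (nodal v) k.-1 else 0).
Proof.
move=> N0 hK hk; rewrite /nodal mxE /= /site inordK; last by lia.
have eN : mesh R N ^+ 2 = (N%:R ^+ 2)^-1 by rewrite /mesh exprVn.
rewrite eN !invrK ifF; last by apply/negbTE/eqP; lia.
have [hat|hat] := boolP (N - K <= k.+1 <= N + K)%N.
  rewrite ifT; last by lia.
  case: k hk hat => [|k] hk hat; first lia.
  have [] : [/\ absz (k.+2%:Z - N%:Z + 2 + N%:Z) = k.+4,
      absz (k.+2%:Z - N%:Z + 1 + N%:Z) = k.+3,
      absz (k.+2%:Z - N%:Z + N%:Z) = k.+2,
      absz (k.+2%:Z - N%:Z - 1 + N%:Z) = k.+1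
    & absz (k.+2%:Z - N%:Z - 2 + N%:Z) = k] by split; lia.
  rewrite /entry => -> -> -> -> ->.
  by rewrite /= /diff4 /diff3 /diff2 /diff1 /nodal; ring.
rewrite ifF; last by apply/negbTE; lia.
have [] : [/\ absz (k.+1%:Z - N%:Z + 1 + N%:Z) = k.+2,
    absz (k.+1%:Z - N%:Z + N%:Z) = k.+1
  & absz (k.+1%:Z - N%:Z - 1 + N%:Z) = k] by split; lia.
rewrite /entry => -> -> ->.
by rewrite /diff2 /diff1 /nodal; ring.
Qed.

Lemma sum_window {V : nmodType} (F : nat -> V) (a n M : nat) :
  (a + n <= M)%N ->
  \sum_(k < M) (if (a <= k < a + n)%N then F k else 0) = \sum_(j < n) F (a + j)%N.
Proof.
move=> le_anM; rewrite -(subnKC le_anM) !big_split_ord /=.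
rewrite big1 ?add0r => [|i _]; last by case: ifP => // ?; have := ltn_ord i; lia.
rewrite [X in _ + X]big1 ?addr0 => [|i _]; last by case: ifP => // ?; lia.
by apply: eq_bigr => i _; rewrite ifT //; have := ltn_ord i; lia.
Qed.

Lemma V0_nodal {R : realType} (N : nat) (v : 'rV[R]_(2 * N).+1) :
  V0 v <-> nodal v 0 = 0 /\ nodal v (2 * N) = 0.
Proof.
rewrite /V0 /= /entry /nodal.
have -> : absz (- N%:Z + N%:Z) = 0%N by lia.
by have -> : absz (N%:Z + N%:Z) = (2 * N)%N by lia.
Qed.

(** The nearest neighbour part is summed over the whole chain, whose ends are
fixed, and so contributes no boundary term. *)
Lemma ip_Lqcf {R : realType} (phiF phi2F : R) (N K : nat)
    (v : 'rV[R]_(2 * N).+1) :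
  (K + 2 <= N)%N -> V0 v ->
  ip (mesh R N) (Lqcf phiF phi2F K v) v =
  qcf_form phiF phi2F N (N - K - 2) (2 * K).+1 (nodal v).
Proof.
move=> hK /V0_nodal[]; set f := nodal v => f0 fN; rewrite /ip.
have Nn0 : N%:R != 0 :> R by rewrite pnatr_eq0; lia.
under eq_bigr => i _ do rewrite -{1 2}[i]inord_val.
rewrite -(big_mkord xpredT (fun i => mesh R N * nodal (Lqcf phiF phi2F K v) i * f i)).
set g := nodal (Lqcf _ _ _ _).
have [m em] : exists m, (2 * N = m.+1)%N by exists (2 * N).-1; lia.
rewrite [X in \sum_(0 <= i < X.+1) _]em big_nat_recl // big_nat_recr //=.
rewrite -em fN f0 !mulr0 add0r addr0.
have -> : \sum_(0 <= k < m) mesh R N * g k.+1 * f k.+1 =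
  - (phiF + 4 * phi2F) * N%:R * (\sum_(k < m) diff2 f k * f k.+1)
  - phi2F * N%:R * \sum_(k < m) (if (N - K - 1 <= k < N - K - 1 + (2 * K).+1)%N then
       diff4 f k.-1 * f k.+1 else 0).
  rewrite !mulr_sumr -sumrB big_mkord; apply: eq_bigr => k _.
  rewrite /g Lqcf_nodal; try by have := ltn_ord k; lia.
  rewrite -/f /mesh.
  have -> : (N - K <= k.+1 <= N + K)%N
      = (N - K - 1 <= k < N - K - 1 + (2 * K).+1)%N by lia.
  by case: ifP => _; field.
rewrite sum_diff2_mul (sum_window (fun k => diff4 f k.-1 * f k.+1)); last lia.
have -> : diff1 f m * f m - diff1 f 0 * f 0 - energy f m = - energy f m.+1.
  by rewrite /energy big_ord_recr /= f0 /diff1 -em fN; ring.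
have -> : \sum_(j < (2 * K).+1) diff4 f (N - K - 1 + j).-1 * f (N - K - 1 + j).+1
  = \sum_(j < (2 * K).+1) diff4 f (N - K - 2 + j) * f (N - K - 2 + j).+2.
  by apply: eq_bigr => j _; congr (diff4 f _ * f _); lia.
by rewrite /qcf_form -em; ring.
Qed.

Lemma norm_Ddiff {R : realType} (N : nat) (v : 'rV[R]_(2 * N).+1) :
  (0 < N)%N ->
  l2norm (mesh R N) (Ddiff v) = Num.sqrt (N%:R * energy (nodal v) (2 * N)).
Proof.
move=> N0; rewrite /l2norm; congr Num.sqrt.
have Nn0 : N%:R != 0 :> R by rewrite pnatr_eq0; lia.
rewrite /energy !mulr_sumr; apply: eq_bigr => i _.
rewrite real_normK ?num_real // mxE /mesh /nodal /diff1 /nodal.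
have -> : lift ord0 i = inord i.+1 by apply/val_inj; rewrite /= inordK // ltnS.
have -> : widen_ord (leqnSn (2 * N)) i = inord i.
  by apply/val_inj; rewrite /= inordK // ltnS ltnW.
by field.
Qed.

Lemma norm_Ddiff_eq1 {R : realType} (N : nat) (v : 'rV[R]_(2 * N).+1) :
  (0 < N)%N ->
  l2norm (mesh R N) (Ddiff v) = 1 <-> N%:R * energy (nodal v) (2 * N) = 1.
Proof.
move=> N0; rewrite norm_Ddiff //; split=> [h|->]; last exact: sqrtr1.
rewrite -[LHS]sqr_sqrtr ?h ?expr1n // mulr_ge0 ?sumr_ge0 // => *.
exact: sqr_ge0.
Qed.

(** * An unstable displacement *)

(** The truncated subtraction only matters beyond the last node [2 * N]. The
final division by 2 normalizes the strain when [t ^ 2 = 1 / N]: tent and spike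
then carry half of the energy each. *)
Definition spiked_tent {R : realFieldType} (N q : nat) (t : R) (i : nat) : R :=
  ((if (i <= N)%N then i else 2 * N - i)%N%:R / N%:R + (i == q)%:R * t) / 2.

Lemma diff1_spiked_tent {R : realFieldType} (N q i : nat) (t : R) :
  (0 < N)%N -> (i < 2 * N)%N ->
  diff1 (spiked_tent N q t) i =
  ((if (i < N)%N then 1 else -1) / N%:R + ((i.+1 == q)%:R - (i == q)%:R) * t) / 2.
Proof.
move=> N0 hi; rewrite /diff1 /spiked_tent.
have Nn0 : N%:R != 0 :> R by rewrite pnatr_eq0; lia.
case: (ltnP i N) => h.
  by rewrite (ltnW h) -natr1; field.
have -> : (if (i <= N)%N then i else 2 * N - i)%N = (2 * N - i.+1).+1 by case: ifP; lia.
by rewrite -natr1; field.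
Qed.

(** The spike sits on one flank of the tent, where the slope is constant; it
raises one increment and lowers the next by the same amount, so that the cross
terms cancel. *)
Lemma energy_spiked_tent {R : realFieldType} (N q : nat) (t : R) :
  (N < q < 2 * N)%N -> N%:R * t ^+ 2 = 1 ->
  N%:R * energy (spiked_tent N q t) (2 * N) = 1.
Proof.
move=> /andP[hq hq2] ht.
have N0 : (0 < N)%N by lia.
have Nn0 : N%:R != 0 :> R by rewrite pnatr_eq0; lia.
have ind (r : nat) : (r < 2 * N)%N -> \sum_(i < 2 * N) (((i : nat) == r)%:R : R) = 1.
  move=> hr; rewrite (bigD1 (Ordinal hr)) //= eqxx big1 ?addr0 // => i hi.
  by rewrite -val_eqE /= in hi; rewrite (negbTE hi).
have -> : energy (spiked_tent N q t) (2 * N) =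
  \sum_(i < 2 * N) (1 / (4 * N%:R ^+ 2)
     + (- t / (2 * N%:R)) * (((i : nat) == q.-1)%:R - ((i : nat) == q)%:R)
     + t ^+ 2 / 4 * (((i : nat) == q.-1)%:R + ((i : nat) == q)%:R)).
  apply: eq_bigr => i _; rewrite diff1_spiked_tent //.
  have -> : (i.+1 == q) = ((i : nat) == q.-1) by apply/eqP/eqP => /=; lia.
  case: (ltnP i N) => h.
    have [-> ->] : ((i : nat) == q.-1) = false /\ ((i : nat) == q) = false.
      by split; apply/eqP => /=; lia.
    by rewrite /=; field.
  case: eqP => [->|_]; first by rewrite (_ : (q.-1 == q) = false) /=; [field|apply/eqP; lia].
  by case: eqP => _ /=; field.
rewrite !big_split /= -!mulr_sumr sumrB big_split /= !ind; try lia.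
rewrite sumr_const card_ord -[_ *+ (2 * N)]mulr_natr natrM.
have -> : t ^+ 2 = N%:R^-1 by apply: (mulfI Nn0); rewrite ht mulfV.
by field.
Qed.

(** The left stencil [N - K - 2, ..., N - K + 1] lies on the rising flank,
where third differences vanish. The right one [N + K - 1, ..., N + K + 2] lies
beyond the kink of the tent, or touches it, and sees the spike with its last
node only. *)
Lemma interface_spiked_tent {R : realFieldType} (N K : nat) (t : R) :
  (0 < K)%N -> (K + 2 < N)%N ->
  interface (spiked_tent N (N + K + 2) t) (N - K - 2) (2 * K).+1
  = t / 4 * (1 - K%:R / N%:R).
Proof.
move=> K0 hK; rewrite /interface; set f := spiked_tent _ _ _.
have Nn0 : N%:R != 0 :> R by rewrite pnatr_eq0; lia.
have d3 i : diff3 f i = f i.+3 - 3 * f i.+2 + 3 * f i.+1 - f i.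
  by rewrite /diff3 /diff2 /diff1; ring.
have fl i : (i <= N)%N -> f i = i%:R / N%:R / 2.
  move=> hi; rewrite /f /spiked_tent hi (_ : i == _ = false) ?mul0r ?addr0 //.
  by apply/eqP; lia.
have fr i : (N < i < 2 * N)%N ->
    f i = ((2 * N%:R - i%:R) / N%:R + (i == N + K + 2)%N%:R * t) / 2.
  move=> /andP[h1 h2]; rewrite /f /spiked_tent ifF; last by apply/negbTE; lia.
  by rewrite natrB ?natrM // ltnW.
have -> : diff3 f (N - K - 2) = 0.
  by rewrite d3 !fl; try lia; rewrite -!natr1; field.
have -> : (N - K - 2 + (2 * K).+1 = N + K.-1)%N by lia.
case: K K0 hK @f d3 fl fr => [//|K] _ hK f d3 fl fr /=.
have e i : ((N + K + i)%N == (N + K.+1 + 2)%N) = (i == 3) by apply/eqP/eqP; lia.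
(* From here on the half-width is [K.+1], so this is the first node of the right
   stencil; it may be the top of the tent. *)
have fk : f (N + K)%N = (N%:R - K%:R) / N%:R / 2.
  case: (posnP K) => [K0|K0]; first by rewrite K0 fl ?addn0 // subr0.
  rewrite fr; last lia.
  by rewrite -[X in X == _]addn0 e natrD /=; field.
have fk' i : (0 < i < 4)%N -> f (N + K + i)%N =
    ((N%:R - K%:R - i%:R) / N%:R + (i == 3)%:R * t) / 2.
  by move=> hi; rewrite fr; [rewrite e !natrD; field | lia].
have := fk' 1%N isT; have := fk' 2%N isT; have := fk' 3%N isT.
by rewrite addn1 addn2 addn3 d3 fk => -> -> -> /=; rewrite -natr1; field.
Qed.

(** * Bounds for the Rayleigh quotient *)

Lemma rayleigh_lower {R : realType} (phiF phi2F : R) (N K : nat)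
    (v : 'rV[R]_(2 * N).+1) :
  0 <= phiF -> (K + 2 <= N)%N -> V0 v -> l2norm (mesh R N) (Ddiff v) = 1 ->
  - ((phiF + 28 * `|phi2F|) * Num.sqrt N%:R)
    <= ip (mesh R N) (Lqcf phiF phi2F K v) v.
Proof.
move=> F0 hK v0; rewrite norm_Ddiff_eq1 ?ip_Lqcf //; last lia.
move=> E1; have /V0_nodal[f0 _] := v0.
have := @qcf_form_interface _ phiF phi2F N (N - K - 2) (2 * K).+1 _ F0 ltac:(lia) E1.
have := @interface_le _ _ N (N - K - 2) (2 * K).+1 f0 ltac:(lia) E1.
set Q := qcf_form _ _ _ _ _ _; set B := N%:R * interface _ _ _; set r := Num.sqrt _ => hB hQ.
have r1 : 1 <= r by rewrite -sqrtr1 ler_wsqrtr // ler1n; lia.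
have hPB : `|phi2F * B| <= `|phi2F| * (16 * r) by rewrite normrM ler_wpM2l.
have h : phiF + 12 * `|phi2F| <= (phiF + 12 * `|phi2F|) * r.
  by rewrite ler_peMr // addr_ge0 // mulr_ge0.
by move: hPB hQ; rewrite !ler_norml => /andP[_ hPB] /andP[hQ _]; lra.
Qed.

(** The interface term has the sign of [phi2F * t], so the spike is given the
sign of [phi2F]. At most half of the tent's height is lost at the right
interface because [2 * K <= N]. *)
Lemma rayleigh_upper {R : realType} (phiF phi2F : R) (N K : nat) :
  0 <= phiF -> phi2F != 0 -> (0 < K)%N -> (K + 2 < N)%N -> (2 * K <= N)%N ->
  exists v : 'rV[R]_(2 * N).+1,
    [/\ V0 v, v != 0, l2norm (mesh R N) (Ddiff v) = 1 &
      ip (mesh R N) (Lqcf phiF phi2F K v) v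
        <= phiF + 12 * `|phi2F| - `|phi2F| / 8 * Num.sqrt N%:R].
Proof.
move=> F0 p0 K0 hK hKN.
set r := Num.sqrt _.
have rr : N%:R = r * r :> R by rewrite -expr2 sqr_sqrtr.
have N0 : 0 < N%:R :> R by rewrite ltr0n; lia.
have r0 : 0 < r by rewrite sqrtr_gt0.
pose t := Num.sg phi2F / r.
have ht : N%:R * t ^+ 2 = 1.
  rewrite rr /t exprMn sqr_sg p0 /=; field; exact: lt0r_neq0.
pose f := spiked_tent N (N + K + 2) t.
pose v : 'rV[R]_(2 * N).+1 := \row_i f i.
have vf i : (i <= 2 * N)%N -> nodal v i = f i.
  by move=> hi; rewrite /nodal mxE inordK.
have v0 : V0 v.
  rewrite V0_nodal !vf // /f /spiked_tent; split.
    by rewrite (_ : (0 == N + K + 2)%N = false) ?mul0r ?addr0 ?mul0r //; lia.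
  rewrite (_ : (2 * N == N + K + 2)%N = false); last lia.
  by rewrite ifF ?subnn ?mul0r ?addr0 ?mul0r //; apply/negbTE; lia.
have ev : energy (nodal v) (2 * N) = energy f (2 * N).
  by apply: eq_bigr => i _; rewrite /diff1 !vf // ltnW.
have Ev : N%:R * energy (nodal v) (2 * N) = 1.
  by rewrite ev energy_spiked_tent //; lia.
have n1 : l2norm (mesh R N) (Ddiff v) = 1 by apply/norm_Ddiff_eq1 => //; lia.
exists v; split => //.
  apply/eqP => v00; move: Ev; rewrite v00 /energy big1 ?mulr0.
    by move/eqP; rewrite eq_sym oner_eq0.
  by move=> i _; rewrite /diff1 /nodal !mxE subrr expr0n.
have iv : interface (nodal v) (N - K - 2) (2 * K).+1 = t / 4 * (1 - K%:R / N%:R).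
  rewrite -interface_spiked_tent // /interface /diff3 /diff2 /diff1 -/f.
  by rewrite !vf; try lia.
rewrite ip_Lqcf //; last lia.
have := @qcf_form_interface _ phiF phi2F N (N - K - 2) (2 * K).+1 _ F0 ltac:(lia) Ev.
set Q := qcf_form _ _ _ _ _ _.
have -> : phi2F * (N%:R * interface (nodal v) (N - K - 2) (2 * K).+1)
    = `|phi2F| * r / 4 * (1 - K%:R / N%:R).
  rewrite iv normrEsg /t rr; field; exact: lt0r_neq0.
have h : K%:R / N%:R <= 1 / 2 :> R.
  rewrite ler_pdivrMr // mulrC mulrA ler_pdivlMr // mulr1 -natrM ler_nat; lia.
have : `|phi2F| * r / 4 * (1 / 2) <= `|phi2F| * r / 4 * (1 - K%:R / N%:R).
  apply: ler_wpM2l; last lra.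
  by rewrite divr_ge0 // mulr_ge0 // ltW.
by rewrite ler_norml => ? /andP[_ ?]; lra.
Qed.

Theorem theorem4p1 (R : realType) (phiF phi2F : R)
    (hF : 0 < phiF) (h2F : phi2F != 0) :
  exists (N0 : nat) (C1 C2 : R),
    [/\ C2 <= C1, 0 < C2 &
      forall N K : nat, (N0 <= N)%N -> (2 <= K)%N -> (2 * K <= N)%N ->
        ~ coercive (Lqcf phiF phi2F (N := N) K) /\
        ((- (C1 * Num.sqrt N%:R))%:E <= rayleigh_inf (Lqcf phiF phi2F (N := N) K)
           <= (- (C2 * Num.sqrt N%:R))%:E)%E].
Proof.
have p0 : 0 < `|phi2F| by rewrite normr_gt0.
(* Once [A <= sqrt N], half of the negative term [|phi2F| / 8 * sqrt N] absorbs
   the constant part of the upper bound. *)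
pose A := 16 * (phiF + 12 * `|phi2F|) / `|phi2F|.
have A0 : 0 <= A by rewrite /A divr_ge0 ?mulr_ge0 ?addr_ge0 ?mulr_ge0 // ltW.
exists (maxn 6 (Num.bound (A ^+ 2))), (phiF + 28 * `|phi2F|), (`|phi2F| / 16).
split; [lra | lra | move=> N K; rewrite geq_max => /andP[N6 hN] hK hKN].
have hr : A <= Num.sqrt N%:R.
  rewrite -[A]ger0_norm // -sqrtr_sqr ler_wsqrtr //.
  apply: ltW; apply: (lt_le_trans (archi_boundP _)); first exact: sqr_ge0.
  by rewrite ler_nat.
have r0 : 0 < Num.sqrt N%:R :> R by rewrite sqrtr_gt0 ltr0n; lia.
move: hr r0; set r := Num.sqrt _ => hr r0.
have hA : 16 * (phiF + 12 * `|phi2F|) <= r * `|phi2F| by rewrite -ler_pdivrMr.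
have [|v [v0 vn0 v1 hv]] := @rayleigh_upper R phiF phi2F N K (ltW hF) h2F ltac:(lia) ltac:(lia).
  exact: hKN.
have {}hv : ip (mesh R N) (Lqcf phiF phi2F K v) v <= - (`|phi2F| / 16 * r).
  apply: (le_trans hv); rewrite -/r; lra.
split.
  move=> /(_ v v0 vn0); apply/negP; rewrite -leNgt; apply: (le_trans hv).
  by rewrite oppr_le0 mulr_ge0 ?divr_ge0 // ltW.
apply/andP; split.
  apply: le_ereal_inf_tmp => _ [w [w0 w1] <-]; rewrite lee_fin.
  by apply: rayleigh_lower => //; [exact: ltW | lia].
apply: (@le_trans _ _ (ip (mesh R N) (Lqcf phiF phi2F K v) v)%:E); last by rewrite lee_fin.
by apply: ereal_inf_lbound; exists v.
Qed.
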